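(* Let $\epsilon\in[0,1]$. Let $C^{\mathrm{fb}}_\epsilon$ be the capacity of the $(1,\infty)$-RLL input-constrained binary erasure channel with feedback, and let $C^{\mathrm{nc}}_\epsilon$ be the capacity of the same channel when, in addition to feedback, the encoder knows before each transmission whether that transmission will be erased (the non-causal setting). Then $$C^{\mathrm{nc}}_\epsilon=C^{\mathrm{fb}}_\epsilon .$$
   Context: Channel. Input alphabet $\mathcal X=\{0,1\}$, output alphabet $\mathcal Y=\{0,1,?\}$. Let $\theta_1,\theta_2,\dots$ be i.i.d. $\mathrm{Ber}(\epsilon)$ erasure indicators, independent of the message; $y_i=x_i$ if $\theta_i=0$ and $y_i=?$ if $\theta_i=1$. Feedback setting. An $(n,2^{nR},(1,\infty))$ code consists of encoding functions $f_i:\{1,\dots,2^{nR}\}\times\mathcal Y^{i-1}\to\mathcal X$, $i=1,\dots,n$, satisfying $f_i(m,y^{i-1})=0$ if $f_{i-1}(m,y^{i-2})=1$, for all $(m,y^{i-1})$, and a decoding function $\Psi:\mathcal Y^n\to\{1,\dots,2^{nR}\}$. Non-causal setting. The encoding functions are instead $f_i:\{1,\dots,2^{nR}\}\times\mathcal Y^{i-1}\times\{0,1\}\to\mathcal X$, with input $x_i=f_i(m,y^{i-1},\theta_i)$, satisfying $f_i(m,y^{i-1},\theta_i)=0$ if $f_{i-1}(m,y^{i-2},\theta_{i-1})=1$, for all $(m,y^{i-1},\theta_{i-1},\theta_i)$; the decoding function is as before. In both settings, the message $M$ is uniform on $\{1,\dots,2^{nR}\}$, $P_e^{(n)}=\Pr(M\neq\Psi(Y^n))$,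 a rate $R$ is achievable if there is a sequence of $(n,2^{nR},(1,\infty))$ codes with $\lim_{n\to\infty}P_e^{(n)}=0$, and the capacity ($C^{\mathrm{fb}}_\epsilon$, respectively $C^{\mathrm{nc}}_\epsilon$) is the supremum of achievable rates. *)

(* Defs.v *)
From HB Require Import structures.
From mathcomp Require Import all_boot all_order all_algebra.
From mathcomp Require Import all_classical all_reals all_analysis.

Set Implicit Arguments.
Unset Strict Implicit.
Unset Printing Implicit Defensive.

Import Order.TTheory GRing.Theory Num.Theory.
Import numFieldNormedType.Exports.

Local Open Scope classical_set_scope.
Local Open Scope ring_scope.

(* Input symbols are booleans ([true] is the symbol 1); [None] is the erasure
   symbol ?. *)
Definition symbol := option bool.

Definition bec (x theta : bool) : symbol := if theta then None else Some x.

(* Messages are 'I_M.  The family f_1, ..., f_n of encoding functions is given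
   by a single function on words over the output alphabet, f_i being its
   restriction to the words of length i - 1; similarly, only the values of a
   decoder on words of length n matter. *)
Definition fb_encoder (M : nat) := 'I_M -> seq symbol -> bool.
Definition nc_encoder (M : nat) := 'I_M -> seq symbol -> bool -> bool.
Definition decoder (M : nat) := seq symbol -> 'I_M.

(* In the constraints below, w is y^(i-2) and z is y_(i-1), with
   i = size w + 2 <= n. *)
Definition fb_rll (n M : nat) (f : fb_encoder M) : Prop :=
  forall (m : 'I_M) (w : seq symbol) (z : symbol),
    ((size w).+2 <= n)%N -> f m w -> ~~ f m (rcons w z).

(* The non-causal constraint ranges over y^(i-1), theta_(i-1) and theta_i, where
   theta_(i-1) is already determined by y_(i-1).  The predicate T selects the
   pairs (y_(i-1), theta_(i-1)) over which the constraint is imposed. *)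
Definition nc_rll (T : symbol -> bool -> Prop) (n M : nat) (f : nc_encoder M) :
    Prop :=
  forall (m : 'I_M) (w : seq symbol) (z : symbol) (theta theta' : bool),
    ((size w).+2 <= n)%N -> T z theta ->
    f m w theta -> ~~ f m (rcons w z) theta'.

(* The pairs that can occur: y_i = ? if and only if theta_i = 1. *)
Definition consistent_pair (z : symbol) (theta : bool) : Prop :=
  z = None <-> theta = true.

Definition any_pair (z : symbol) (theta : bool) : Prop := True.

Record fb_code (n M : nat) := FbCode {
  fb_enc : fb_encoder M;
  fb_dec : decoder M;
  fb_encP : fb_rll n fb_enc }.

Record nc_code (T : symbol -> bool -> Prop) (n M : nat) := NcCode {
  nc_enc : nc_encoder M;
  nc_dec : decoder M;
  nc_encP : nc_rll T n nc_enc }.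

(* [transmit g y th]: continuation of the output word y when the erasure
   indicators still to come are th, and g w theta is the input sent after the
   output w when the current erasure indicator is theta. *)
Fixpoint transmit (g : seq symbol -> bool -> bool) (y : seq symbol)
    (th : seq bool) : seq symbol :=
  if th is t :: th' then transmit g (rcons y (bec (g y t) t)) th' else y.

Definition fb_output (M : nat) (f : fb_encoder M) (m : 'I_M) (th : seq bool) :
  seq symbol := transmit (fun y _ => f m y) [::] th.

Definition nc_output (M : nat) (f : nc_encoder M) (m : 'I_M) (th : seq bool) :
  seq symbol := transmit (f m) [::] th.

Section Capacity.
Context {R : realType}.
Implicit Types (eps r : R).

(* Joint law of (message, erasure indicators): uniform times Ber(eps)^n. *)
Definition joint_pmf eps (n M : nat) (u : 'I_M * n.-tuple bool) : R :=
  M%:R^-1 * \prod_(i < n) bernoulli_pmf eps (tnth u.2 i).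

Definition joint_pr eps (n M : nat) (E : pred ('I_M * n.-tuple bool)) : R :=
  \sum_(u | E u) joint_pmf eps u.

Definition fb_error eps (n M : nat) (c : fb_code n M) : R :=
  @joint_pr eps n M
    (fun u => u.1 != fb_dec c (fb_output (fb_enc c) u.1 u.2)).

Definition nc_error eps (T : symbol -> bool -> Prop) (n M : nat)
    (c : nc_code T n M) : R :=
  @joint_pr eps n M
    (fun u => u.1 != nc_dec c (nc_output (nc_enc c) u.1 u.2)).

(* 2^(n r), rounded up to an integer. *)
Definition num_messages r (n : nat) : nat :=
  `|Num.ceil (2 `^ (n%:R * r))|%N.

Definition fb_achievable eps r : Prop :=
  0 <= r /\
  exists c : forall n, fb_code n (num_messages r n),
    (fun n => fb_error eps (c n)) @ \oo --> (0 : R).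

Definition nc_achievable (T : symbol -> bool -> Prop) eps r : Prop :=
  0 <= r /\
  exists c : forall n, nc_code T n (num_messages r n),
    (fun n => nc_error eps (c n)) @ \oo --> (0 : R).

Definition fb_capacity eps : \bar R :=
  ereal_sup [set r%:E | r in fb_achievable eps].

Definition nc_capacity (T : symbol -> bool -> Prop) eps : \bar R :=
  ereal_sup [set r%:E | r in nc_achievable T eps].

End Capacity.

(* Main.v *)
(* Put sigma = ln (1 + exp (- rho)), so that exp (- sigma) + exp (- sigma - rho) = 1; these
   are the probabilities of sending 0 and 1 that are optimal for the rate rho / ln 2.  Which
   rates are achievable is decided in both settings by the sign of rho - (1 - eps) sigma.

   Converse: let S be the set of messages compatible with the output so far.  An erasure
   leaves S unchanged, a reception splits it, and after a received 1 the next use carries no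
   information.  If rho > (1 - eps) sigma, Hoelder's inequality shows by induction that the
   expected number of messages of S decoded correctly after k more uses is at most
   exp (d rho (k + 1)) |S|^(1 - d) for a small d > 0.  At rates above rho / ln 2 the success
   probability therefore vanishes exponentially.

   Achievability without knowing the erasures: messages are integers in an interval, the top
   fraction p = exp (- sigma - rho) <= 1/2 of the current interval sends 1, and after an
   erasure the bottom fraction p does so instead, so that nobody who has just sent an erased
   1 has to send another 1.  Once a 1 is received everybody sends 0 for one use.  If
   rho < (1 - eps) sigma, the analogous induction with exponent 1 + d bounds the number of
   messages not decoded.  As sigma decreases with rho, the two conditions leave no gap
   between the capacities. *)
Require Import Defs.
From mathcomp Require Import all_boot all_order all_algebra.
From mathcomp Require Import all_classical all_reals all_analysis.
From mathcomp Require Import ring lra.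

Set Implicit Arguments.
Unset Strict Implicit.
Unset Printing Implicit Defensive.

Import Order.TTheory GRing.Theory Num.Theory.
Import numFieldNormedType.Exports.

Local Open Scope ring_scope.

(** * Expectations over i.i.d. erasure indicators *)

Section ErasureMean.
Context {R : realType} (eps : R).

Definition erasure_mean k (F : seq bool -> R) : R :=
  \sum_(t : k.-tuple bool) (\prod_(i < k) bernoulli_pmf eps (tnth t i)) * F t.

Lemma erasure_mean0 F : erasure_mean 0 F = F [::].
Proof.
rewrite /erasure_mean (big_pred1 [tuple]) => [|t]; first by rewrite big_ord0 mul1r.
by apply/esym/eqP; exact: tuple0.
Qed.

Lemma erasure_meanS k F : erasure_mean k.+1 F =
  eps * erasure_mean k (fun th => F (true :: th)) +
  (1 - eps) * erasure_mean k (fun th => F (false :: th)).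
Proof.
rewrite /erasure_mean.
rewrite (reindex (fun p : bool * k.-tuple bool => cons_tuple p.1 p.2)) /=; last first.
  exists (fun t : k.+1.-tuple bool => (thead t, behead_tuple t)) => [[b t] _|t _] /=.
    by congr pair; apply/val_inj.
  by rewrite [RHS]tuple_eta; apply/val_inj.
rewrite -(pair_bigA _ (fun b t => (\prod_(i < k.+1)
  bernoulli_pmf eps (tnth (cons_tuple b t) i)) * F (b :: t))) /= big_bool /=.
by congr (_ + _); rewrite mulr_sumr; apply: eq_bigr => t _;
  rewrite big_ord_recl tnth0 -mulrA; congr (_ * (_ * _));
  apply: eq_bigr => i _; rewrite tnthS.
Qed.

Lemma erasure_meanD k F G :
  erasure_mean k (fun th => F th + G th) = erasure_mean k F + erasure_mean k G.
Proof.
by rewrite /erasure_mean -big_split; apply: eq_bigr => t _; rewrite mulrDr.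
Qed.

Lemma erasure_mean_cst k c : erasure_mean k (fun=> c) = c.
Proof.
by elim: k => [|k IH]; rewrite ?erasure_mean0 // erasure_meanS IH -mulrDl subrKC mul1r.
Qed.

Lemma eq_erasure_mean k F G : F =1 G -> erasure_mean k F = erasure_mean k G.
Proof. by move=> FG; apply: eq_bigr => t _; rewrite FG. Qed.

(* [mean_tally Q g k w S] is the expected number of messages m in S for which Q m
   holds of the final output word, when all of S is compatible with the output
   w and k transmissions remain. *)
Definition mean_tally M (Q : 'I_M -> pred (seq symbol)) (g : nc_encoder M) k
    (w : seq symbol) (S : {set 'I_M}) : R :=
  erasure_mean k (fun th => \sum_(m in S) (Q m (transmit (g m) w th))%:R).

Lemma mean_tally0 M Q (g : nc_encoder M) w S :
  mean_tally Q g 0 w S = #|[set m in S | Q m w]|%:R.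
Proof.
rewrite /mean_tally erasure_mean0 /= -sum1_card natr_sum.
under [RHS]eq_bigl do rewrite inE.
by rewrite [RHS]big_mkcondr; apply: eq_bigr => m _; case: Q.
Qed.

Lemma mean_tallyS M Q (g : nc_encoder M) k w S :
  mean_tally Q g k.+1 w S =
  eps * mean_tally Q g k (rcons w None) S +
  (1 - eps) * (mean_tally Q g k (rcons w (Some false)) [set m in S | ~~ g m w false] +
               mean_tally Q g k (rcons w (Some true)) [set m in S | g m w false]).
Proof.
rewrite /mean_tally erasure_meanS; congr (_ + _ * _).
rewrite -erasure_meanD; apply: eq_erasure_mean => th /=.
rewrite (bigID (fun m => g m w false)) /= addrC.
congr (_ + _).
- apply: eq_big => [m|m /andP[_ /negbTE ->]//]; by rewrite inE.
- apply: eq_big => [m|m /andP[_ ->]//]; by rewrite inE.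
Qed.

Lemma mean_tally_set0 M Q (g : nc_encoder M) k w : mean_tally Q g k w finset.set0 = 0.
Proof.
rewrite /mean_tally (@eq_erasure_mean _ _ (fun=> 0)) ?erasure_mean_cst// => th.
by rewrite big_set0.
Qed.

Lemma mean_tally_compl M Q (g : nc_encoder M) k w S :
  mean_tally Q g k w S + mean_tally (fun m y => ~~ Q m y) g k w S = #|S|%:R.
Proof.
rewrite /mean_tally -erasure_meanD -[RHS](erasure_mean_cst k).
apply: eq_erasure_mean => th; rewrite -big_split /= -sum1_card natr_sum.
by apply: eq_bigr => m _; case: Q => /=; rewrite ?addr0 ?add0r.
Qed.

Lemma mean_tally_ge0 M Q (g : nc_encoder M) k w S : 0 <= eps <= 1 ->
  0 <= mean_tally Q g k w S.
Proof.
move=> e01; apply: sumr_ge0 => t _; rewrite mulr_ge0 ?sumr_ge0//.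
by apply: prodr_ge0 => i _; exact: bernoulli_pmf_ge0.
Qed.

Lemma joint_pr_mean_tally n M (Q : 'I_M -> pred (seq symbol)) (g : nc_encoder M) :
  @joint_pr R eps n M (fun u => Q u.1 (transmit (g u.1) [::] u.2)) =
  M%:R^-1 * mean_tally Q g n [::] finset.setT.
Proof.
rewrite /joint_pr /mean_tally /erasure_mean big_mkcond /= mulr_sumr.
under [RHS]eq_bigr do rewrite !mulr_sumr.
rewrite exchange_big pair_big /=; apply: eq_big => [[m t]|[m t] _] /=.
  by rewrite inE.
by rewrite /joint_pmf /=; case: Q; rewrite ?mulr1 ?mulr0.
Qed.

End ErasureMean.

(* From exp(-x) >= 1 - x: exp (d b) - 1 <= d b / (1 - d b), so the inequality holds as soon
   as d a b <= a - (1 - eps) b. *)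
Lemma small_exponent {R : realType} (eps a b : R) : 0 <= eps <= 1 ->
  (1 - eps) * b < a ->
  exists2 d, 0 < d < 1 & eps + (1 - eps) * expR (d * b) <= expR (d * a).
Proof.
move=> /andP[e0 e1] ba; set g := a - (1 - eps) * b.
have g0 : 0 < g by rewrite subr_gt0.
(* With d = 1/K, the summands of [K] secure d < 1, d b < 1 and d a b <= g. *)
pose K := 2 + `|b| + `|a * b| / g.
have h0 : 0 <= `|a * b| / g by rewrite divr_ge0// ltW.
have K2 : 2 <= K by rewrite /K; have := normr_ge0 b; lra.
have K0 : 0 < K by lra.
exists K^-1; first by rewrite invr_gt0 K0 invf_lt1//; lra.
set d := K^-1; have d0 : 0 < d by rewrite invr_gt0.
have db : d * b < 1.
  rewrite /d mulrC ltr_pdivrMr// mul1r.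
  by have := ler_norm b; rewrite /K; lra.
have dab : d * (a * b) <= g.
  rewrite /d mulrC ler_pdivrMr// /K.
  rewrite mulrDr mulrCA divff ?gt_eqF// mulr1.
  by rewrite (le_trans (ler_norm _))// lerDr mulr_ge0 ?(ltW g0)// addr_ge0.
apply: le_trans (expR_ge1Dx _).
have y0 : 0 < 1 - d * b by lra.
have : expR (d * b) <= (1 - d * b)^-1.
  rewrite -[leLHS]invrK -expRN lef_pV2 ?posrE ?expR_gt0//.
  exact: expR_ge1Dx.
set y := 1 - d * b => ey.
have := ler_wpM2l (_ : 0 <= 1 - eps) ey; rewrite subr_ge0 => /(_ e1) H.
apply: le_trans (_ : eps + (1 - eps) / y <= _); first by rewrite lerD2l.
have -> : (1 - eps) / y = (1 - eps) + d * ((1 - eps) * b / y) by rewrite /y; field; rewrite gt_eqF.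
suff : (1 - eps) * b / y <= a by move=> /(ler_wpM2l (ltW d0)); lra.
by rewrite ler_pdivrMr// /y; move: dab; rewrite /g; lra.
Qed.

(** * Converse for the non-causal setting *)

Section Converse.
Context {R : realType} (eps d rho : R).
Hypothesis e01 : 0 <= eps <= 1.
Hypothesis d01 : 0 < d < 1.

(** Hoelder's inequality with exponents 1/(1 - d) and 1/d for the vectors (a^(1 - d), b^(1 - d)) and
    (1, exp (- d rho)); the second has norm (1 + exp (- rho))^d. *)
Lemma holder_split (a b : R) : 0 <= a -> 0 <= b ->
  a `^ (1 - d) + expR (- (d * rho)) * b `^ (1 - d) <=
  expR (d * ln (1 + expR (- rho))) * (a + b) `^ (1 - d).
Proof.
move=> a0 b0; case/andP: d01 => d0 d1.
have d1' : 0 < 1 - d by lra.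
have := @hoelder2 R (a `^ (1 - d)) (b `^ (1 - d)) 1 (expR (- (d * rho)))
  (1 - d)^-1 d^-1 (powR_ge0 _ _) (powR_ge0 _ _) ler01 (expR_ge0 _).
rewrite !invr_gt0 !invrK subrK => /(_ d1' d0 erefl).
rewrite -!powRrM divff ?gt_eqF// !powRr1// powR1 -expRM mulNr (mulrC d) mulfK ?gt_eqF//.
rewrite mulr1 (mulrC (b `^ _)) => /le_trans; apply.
rewrite mulrC ler_wpM2r ?powR_ge0//.
by rewrite (mulrC d) expRM lnK// posrE addr_gt0 ?expR_gt0.
Qed.

Hypothesis rho0 : 0 <= rho.
Hypothesis rate_gt : eps + (1 - eps) * expR (d * ln (1 + expR (- rho))) <= expR (d * rho).

(** Induction on the remaining uses. The second bound saves a factor exp (d rho) when no message of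
    [S] would send an unerased 1 next; this saving is the weight exp (- d rho) in [holder_split]. *)
Lemma decoded_tally_le n M (f : nc_encoder M) (dec : decoder M) :
  nc_rll consistent_pair n f -> forall k w S, (size w + k = n)%N ->
  let V := mean_tally eps (fun m y => m == dec y) f k w S in
  V <= expR (d * rho) ^+ k.+1 * #|S|%:R `^ (1 - d) /\
  (((0 < k)%N -> forall m, m \in S -> ~~ f m w false) ->
     V <= expR (d * rho) ^+ k * #|S|%:R `^ (1 - d)).
Proof.
case/andP: e01 => e0 e1; case/andP: d01 => d0 d1 frll.
set L := expR (d * rho).
have L0 : 0 < L by exact: expR_gt0.
have L1 : 1 <= L by rewrite -expR0 ler_expR mulr_ge0// ltW.
elim=> [|k IH] w S wk /=.
  (* With no use left, at most one message of [S] is decoded, and none if [S] is empty. *)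
  have H : mean_tally eps (fun m y => m == dec y) f 0 w S <= #|S|%:R `^ (1 - d).
    rewrite mean_tally0; have [->|] := eqVneq S finset.set0.
      rewrite (_ : [set _ in _ | _] = finset.set0) ?cards0 ?powR_ge0//.
      by apply/setP => m; rewrite !inE.
    rewrite -card_gt0 => S0; apply: (@le_trans _ _ 1).
      rewrite -[1]/(1%:R) ler_nat -(cards1 (dec w)) subset_leq_card//.
      by apply/fintype.subsetP => m; rewrite !inE => /andP[].
    have := @ge0_ler_powR R (1 - d) _ 1 #|S|%:R; rewrite powR1; apply.
    - by lra.
    - by rewrite nnegrE.
    - by rewrite nnegrE.
    - by rewrite ler1n.
  rewrite expr0 mul1r expr1; split=> //.
  by rewrite (le_trans H)// ler_peMl// powR_ge0.
have wk' z : (size (rcons w z) + k = n)%N by rewrite size_rcons addSnnS.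
rewrite mean_tallyS; set S0 := [set m in S | ~~ f m w false].
set S1 := [set m in S | f m w false].
have [IH0 _] := IH _ S0 (wk' (Some false)).
have [IHe _] := IH _ S (wk' None).
have cardS : #|S|%:R = #|S0|%:R + #|S1|%:R :> R.
  rewrite -natrD addnC -(cardsID [set m | f m w false] S) /S0 /S1; congr (_ + _)%:R.
    by apply: eq_card => m; rewrite !inE.
  by apply: eq_card => m; rewrite !inE andbC.
split=> [|/(_ isT) Sf].
(* The constraint silences the senders of a received 1, so the sharper bound applies. For k = 0
   there is no next use, whence the guard [(0 < k)%N]. *)
- have IH1 : mean_tally eps (fun m y => m == dec y) f k (rcons w (Some true)) S1 <=
      L ^+ k * #|S1|%:R `^ (1 - d).
    apply: (IH _ _ (wk' _)).2 => k0 m; rewrite inE => /andP[_ fm].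
    by apply: (frll _ _ _ false) fm => //; rewrite -wk -addn2 leq_add2l.
  have HS := holder_split (ler0n _ #|S0|) (ler0n _ #|S1|).
  rewrite -cardS in HS.
  set t := mean_tally eps _ f k _ S in IHe *.
  apply: (@le_trans _ _ (L ^+ k.+1 * #|S|%:R `^ (1 - d) *
      (eps + (1 - eps) * expR (d * ln (1 + expR (- rho)))))); last first.
    by rewrite [L ^+ k.+2]exprSr [leRHS]mulrAC ler_wpM2l// mulr_ge0 ?powR_ge0// exprn_ge0// ltW.
  rewrite [leRHS]mulrDr lerD//; first by rewrite mulrC ler_wpM2r.
  rewrite mulrCA ler_wpM2l ?subr_ge0// -mulrA (mulrC (_ `^ _)).
  apply: (@le_trans _ _ (L ^+ k.+1 * (#|S0|%:R `^ (1 - d) +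
     expR (- (d * rho)) * #|S1|%:R `^ (1 - d)))); last first.
    by rewrite ler_wpM2l// exprn_ge0// ltW.
  by rewrite mulrDr lerD// expRN exprSr mulrA mulfK ?gt_eqF.
(* Erasure and reception both leave [S] whole here. *)
- rewrite (_ : S1 = finset.set0); last first.
    by apply/setP => m; rewrite !inE; apply/negP => /andP[/Sf /negbTE ->].
  have S0S : S0 = S.
    by apply/setP => m; rewrite !inE; apply: andb_idr => /Sf.
  rewrite mean_tally_set0 addr0; rewrite S0S in IH0 *.
  have := ler_wpM2l e0 IHe.
  by have := ler_wpM2l (_ : 0 <= 1 - eps) IH0; rewrite subr_ge0 => /(_ e1); lra.
Qed.

End Converse.

(** Rounding up costs at most a factor 2 because 2^(n r) >= 1. *)
Lemma num_messages_bounds {R : realType} (r : R) n : 0 <= r ->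
  expR (n%:R * (r * ln 2)) <= (num_messages r n)%:R <=
  2 * expR (n%:R * (r * ln 2)).
Proof.
move=> r0; rewrite /num_messages /powR pnatr_eq0 /= -mulrA.
set x := expR _; have x0 : 0 < x by exact: expR_gt0.
have x1 : 1 <= x by rewrite -expR0 ler_expR !mulr_ge0// ln_ge0// ler1n.
have c0 : 0 <= Num.ceil x by rewrite ceil_ge0 (lt_trans _ x0)// oppr_lt0.
rewrite natr_absz ger0_norm// ceil_ge /=.
have := @real_ceilB1_lt R x (num_real _).
by rewrite intrB; lra.
Qed.

Lemma expR_geometric {R : realType} (c s : R) : 0 < s ->
  ((fun n => c * expR (- s) ^+ n) @ \oo --> (0 : R))%classic.
Proof.
move=> s0; apply: cvg_geometric.
by rewrite ger0_norm ?expR_ge0// expR_lt1 oppr_lt0.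
Qed.

Lemma nc_success_le {R : realType} (eps d rho : R) n M
    (c : nc_code consistent_pair n M) :
  0 <= eps <= 1 -> 0 < d < 1 -> 0 <= rho -> (0 < M)%N ->
  eps + (1 - eps) * expR (d * ln (1 + expR (- rho))) <= expR (d * rho) ->
  1 - nc_error eps c <= expR (d * rho) ^+ n.+1 * M%:R `^ (- d).
Proof.
move=> e01 d01 rho0 M0 rate.
have MR : (0 : R) < M%:R by rewrite ltr0n.
rewrite /nc_error /nc_output (joint_pr_mean_tally eps n (fun m y => m != nc_dec c y)).
set t := mean_tally _ _ _ _ _ _.
have [H _] := decoded_tally_le e01 d01 rho0 rate (nc_dec c) (@nc_encP _ _ _ c)
  finset.setT (erefl : (size (Nil symbol) + n)%N = n).
have := mean_tally_compl eps (fun m y => m == nc_dec c y)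
  (nc_enc c) n [::] finset.setT.
rewrite cardsT card_ord -/t => /(canRL (addrK _)) Et.
rewrite Et cardsT card_ord in H.
have -> : 1 - M%:R^-1 * t = M%:R^-1 * (M%:R - t) by rewrite mulrBr mulVf ?gt_eqF.
apply: le_trans (ler_wpM2l (ltW _) H) _; first by rewrite invr_gt0.
rewrite mulrCA ler_wpM2l ?exprn_ge0 ?expR_ge0//.
by rewrite powRD ?(gt_eqF MR) ?implybT// powRr1 ?ler0n// mulKf ?gt_eqF.
Qed.

(** Otherwise the success probability, which tends to 1, would decay like exp (- n d (r ln 2 -
    rho)). *)
Lemma nc_converse {R : realType} (eps r rho : R) : 0 <= eps <= 1 -> 0 <= rho ->
  (1 - eps) * ln (1 + expR (- rho)) < rho ->
  nc_achievable consistent_pair eps r -> r * ln 2 <= rho.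
Proof.
move=> e01 rho0 rate [r0 [c errc]]; rewrite leNgt; apply/negP => rhor.
have [d d01 hd] := small_exponent e01 rate.
have /andP[d0 d1] := d01.
have s0 : 0 < d * (r * ln 2 - rho) by rewrite mulr_gt0// subr_gt0.
suff : (1 : R) - 0 <= 0 by rewrite subr0 ler10.
apply: (ler_cvg_to (cvgB (cvg_cst _) (expR_geometric (expR (d * rho)) s0)) errc).
apply: nearW => n /=; rewrite lerBlDr addrC -lerBlDr.
have /andP[Mge _] := num_messages_bounds n r0.
have MR := lt_le_trans (expR_gt0 _) Mge.
apply: le_trans (nc_success_le _ e01 d01 rho0 _ hd) _; first by rewrite -(ltr0n R).
rewrite exprS -mulrA ler_wpM2l ?expR_ge0// -!expRM_natl.
rewrite /powR gt_eqF// -expRD ler_expR.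
have lnM : n%:R * (r * ln 2) <= ln (num_messages r n)%:R.
  by rewrite -[leLHS]expRK ler_ln ?posrE ?expR_gt0.
by have := ler_wpM2l (ltW d0) lnM; lra.
Qed.

(** * Interval scheme with feedback *)

Lemma card_le_diameter {R : realType} M (S : {set 'I_M}) (l : R) :
  (forall i j, i \in S -> j \in S -> j%:R - i%:R < l) -> (0 < #|S|)%N ->
  #|S|%:R <= l + 1.
Proof.
move=> Sl; rewrite card_gt0 => /set0Pn[m0 Sm0].
have [i Si imin] := arg_minnP (fun i : 'I_M => i : nat) Sm0.
have [j Sj jmax] := arg_maxnP (fun i : 'I_M => i : nat) Sm0.
have ij : (i <= j)%N := imin _ Sj.
have : (#|S| <= (j - i).+1)%N.
  rewrite -(size_iota i (j - i).+1) cardE -(size_map val).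
  apply: uniq_leq_size => [|x /mapP[m]].
    by rewrite map_inj_uniq ?enum_uniq//; exact: val_inj.
  rewrite mem_enum => Sm ->; rewrite mem_iota imin//= addnS ltnS subnKC//.
  exact: jmax.
rewrite -(ler_nat R) => /le_trans; apply.
rewrite -natr1 lerD2r natrB//; exact/ltW/Sl.
Qed.

Variant phase := Top | Bottom | Rest.

Section Scheme.
Context {R : realType} (p q : R).
Hypotheses (p_ge0 : 0 <= p) (p_le_q : p <= q) (pq1 : q + p = 1).

(* The state (ph, a, l) means that the messages compatible with the output are
   those in [a, a + l[; the symbol 1 is sent by the top (resp. bottom) fraction
   p of this interval, and by nobody in the phase Rest, which follows each
   received 1. *)
Definition state : Type := phase * R * R.

Definition sends (s : state) (x : R) : bool :=
  let: (ph, a, l) := s in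
  match ph with
  | Top => a + q * l <= x < a + l
  | Bottom => a <= x < a + p * l
  | Rest => false
  end.

(** A use in phase [Rest] carries no information, so its output is ignored. *)
Definition update (s : state) (z : symbol) : state :=
  let: (ph, a, l) := s in
  match ph, z with
  | Top, None => (Bottom, a, l)
  | Top, Some false => (Top, a, q * l)
  | Top, Some true => (Rest, a + q * l, p * l)
  | Bottom, None => (Top, a, l)
  | Bottom, Some false => (Top, a + p * l, q * l)
  | Bottom, Some true => (Rest, a, p * l)
  | Rest, _ => (Top, a, l)
  end.

Definition inside (s : state) (x : R) : bool :=
  let: (_, a, l) := s in a <= x < a + l.

Definition resting (s : state) : bool := if s.1.1 is Rest then true else false.

Lemma update_len_ge0 s z : 0 <= s.2 -> 0 <= (update s z).2.
Proof.
have q0 : 0 <= q by exact: le_trans p_le_q.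
by case: s => [[[] a] l] /=; case: z => [[]|] //= l0; rewrite mulr_ge0.
Qed.

(* The top and bottom fractions are disjoint because p <= 1/2. *)
Lemma sends_update s z x : 0 <= s.2 -> sends s x -> ~~ sends (update s z) x.
Proof.
have q0 : 0 <= q by exact: le_trans p_le_q.
case: s => [[ph a] l] /= l0; have pql := ler_wpM2r l0 p_le_q.
have ql0 := mulr_ge0 q0 l0; have qql0 := mulr_ge0 q0 ql0.
by case: ph => // /andP[h1 h2]; case: z => [[]|] //=;
  apply/negP => /andP[h3 h4]; lra.
Qed.

Lemma sends_resting s x : resting s -> sends s x = false.
Proof. by case: s => [[[] a] l]. Qed.

Lemma inside_update_resting s z x : resting s -> inside (update s z) x = inside s x.
Proof. by case: s => [[[] a] l] // _; case: z => [[]|]. Qed.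

Lemma inside_update_erased s x : inside (update s None) x = inside s x.
Proof. by case: s => [[[] a] l]. Qed.

Lemma inside_update_sent s b x : 0 <= s.2 -> ~~ resting s ->
  inside (update s (Some b)) x = inside s x && (sends s x == b).
Proof.
have q0 : 0 <= q by exact: le_trans p_le_q.
case: s => [[ph a] l] /= l0.
have ql : 0 <= q * l by rewrite mulr_ge0.
have pl : 0 <= p * l by rewrite mulr_ge0.
have lE : l = q * l + p * l by rewrite -mulrDl pq1 mul1r.
by case: ph => // _; case: b => /=; rewrite ?eqb_id ?eqbF_neg;
  apply/idP/idP => [/andP[]|];
  rewrite ?negb_and -?leNgt -?ltNge; lra.
Qed.

Variables (M : nat) (m0 : 'I_M).

Definition state_after (w : seq symbol) : state := foldl update (Top, 0, M%:R) w.

Lemma state_after_rcons w z : state_after (rcons w z) = update (state_after w) z.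
Proof. exact: foldl_rcons. Qed.

Lemma state_after_len_ge0 w : 0 <= (state_after w).2.
Proof.
elim/last_ind: w => [|w z IH]; first exact: ler0n.
by rewrite state_after_rcons update_len_ge0.
Qed.

Definition interval_enc : fb_encoder M := fun m w => sends (state_after w) m%:R.

Definition interval_dec : decoder M := fun w =>
  odflt m0 [pick m : 'I_M | inside (state_after w) m%:R].

Lemma interval_rll n : fb_rll n interval_enc.
Proof.
move=> m w z _; rewrite /interval_enc state_after_rcons.
exact/sends_update/state_after_len_ge0.
Qed.

Definition interval_code n : fb_code n M := FbCode interval_dec (@interval_rll n).

Definition compatible (w : seq symbol) : {set 'I_M} :=
  [set m : 'I_M | inside (state_after w) m%:R].

(** An interval of length l holds at most l + 1 messages. If some compatible message is missed,
    another one is decoded, so at most l are missed; then l >= 1 and l <= l^(1 + d). *)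
Lemma undecoded_le w (d : R) : 0 <= d ->
  #|[set m in compatible w | m != interval_dec w]|%:R <= (state_after w).2 `^ (1 + d).
Proof.
move=> d0; set U := [set m in _ | _]; set l := (state_after w).2.
have [->|U0] := eqVneq #|U| 0%N; first exact: powR_ge0.
have [u] : exists u, u \in U by apply/set0Pn; rewrite -card_gt0 lt0n.
rewrite inE => /andP[cu _].
have cdec : interval_dec w \in compatible w.
  move: cu; rewrite /interval_dec inE; case: pickP => [m im|no]; first by rewrite inE.
  by rewrite no.
have UE : U = compatible w :\ interval_dec w by apply/setP => m; rewrite !inE andbC.
have : #|compatible w|%:R <= l + 1.
  apply: card_le_diameter => [i j|]; last by rewrite card_gt0; apply/set0Pn; exists u.
  rewrite !inE /l; case: state_after => [[ph a] l'] /= /andP[? ?] /andP[? ?]; lra.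
rewrite (cardsD1 (interval_dec w)) cdec -UE natrD addrC lerD2r => Ul.
apply: (le_trans Ul); apply: le1r_powR; last by rewrite lerDl.
by apply: le_trans Ul; rewrite ler1n lt0n.
Qed.

(** Induction with potential l^(1 + d), l being the interval length, and decay [L] per use; the
    factor 1/L in phase [Rest] pays in advance for the use about to be lost. *)
Lemma undecoded_tally_le (eps d L : R) : 0 <= eps <= 1 -> 0 <= d -> 0 < L -> L <= 1 ->
  eps + (1 - eps) * (q `^ (1 + d) + L^-1 * p `^ (1 + d)) <= L -> forall k w,
  mean_tally eps (fun m y => m != interval_dec y) (fun m y _ => interval_enc m y)
    k w (compatible w) <=
  L ^+ k * ((if resting (state_after w) then L^-1 else 1) *
    (state_after w).2 `^ (1 + d)).
Proof.
move=> /andP[e0 e1] d0 L0 L1 rate.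
have q0 : 0 <= q by exact: le_trans p_le_q.
elim=> [|k IH] w.
  rewrite mean_tally0 expr0 mul1r (le_trans (undecoded_le _ d0))// ler_peMl ?powR_ge0//.
  by case: resting => //; rewrite invf_ge1.
rewrite mean_tallyS.
set S0 := [set m in _ | _]; set S1 := [set m in _ | _].
have ce : compatible (rcons w None) = compatible w.
  by apply/setP => m; rewrite !inE state_after_rcons inside_update_erased.
have e1' : 0 <= 1 - eps by rewrite subr_ge0.
have IHe := IH (rcons w None); rewrite ce in IHe.
have [rest|nrest] := boolP (resting (state_after w)).
  have -> : S1 = finset.set0.
    by apply/setP => m; rewrite !inE /interval_enc sends_resting ?andbF.
  have -> : S0 = compatible (rcons w (Some false)).
    apply/setP => m; rewrite !inE /interval_enc sends_resting ?andbT//.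
    by rewrite state_after_rcons inside_update_resting.
  rewrite mean_tally_set0 addr0.
  have IH0 := IH (rcons w (Some false)).
  (* The factor 1/L cancels one factor of L^(k + 1); every output leads to [Top] with the same
     interval. *)
  rewrite exprSr -mulrA mulVKf ?gt_eqF//.
  have E z : (if resting (state_after (rcons w z)) then L^-1 else 1) *
      (state_after (rcons w z)).2 `^ (1 + d) = (state_after w).2 `^ (1 + d).
    rewrite state_after_rcons.
    by move: rest; case: state_after => [[[] a] l]//= _; rewrite mul1r.
  rewrite !E in IHe IH0.
  by have := ler_wpM2l e0 IHe; have := ler_wpM2l e1' IH0; lra.
have SE b : [set m in compatible w | interval_enc m w == b] = compatible (rcons w (Some b)).
  apply/setP => m; rewrite !inE state_after_rcons inside_update_sent//.
  exact: state_after_len_ge0.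
have -> : S1 = compatible (rcons w (Some true)).
  by rewrite -SE; apply/setP => m; rewrite !inE eqb_id.
have -> : S0 = compatible (rcons w (Some false)).
  by rewrite -SE; apply/setP => m; rewrite !inE eqbF_neg.
have IH0 := IH (rcons w (Some false)); have IH1 := IH (rcons w (Some true)).
move: (state_after_len_ge0 w) nrest IHe IH0 IH1; rewrite !state_after_rcons.
case: (state_after w) => [[ph a] l] /= l0; set t := l `^ _ => nrest.
have t0 : 0 <= t by exact: powR_ge0.
set Te := mean_tally _ _ _ _ _ _; set T0 := mean_tally _ _ _ _ _ _.
set T1 := mean_tally _ _ _ _ _ _.
move=> IHe IH0 IH1.
have Le : Te <= L ^+ k * t.
  by move: nrest IHe {IH0 IH1}; case: ph => //= _; rewrite mul1r.
have Lq : T0 <= L ^+ k * (q `^ (1 + d) * t).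
  by move: nrest IH0 {IHe IH1}; case: ph => //= _; rewrite mul1r powRM.
have Lp : T1 <= L ^+ k * (L^-1 * (p `^ (1 + d) * t)).
  by move: nrest IH1 {IHe IH0}; case: ph => //= _; rewrite powRM.
rewrite mul1r.
apply: (@le_trans _ _ (L ^+ k * t *
    (eps + (1 - eps) * (q `^ (1 + d) + L^-1 * p `^ (1 + d))))); last first.
  by rewrite exprSr [leRHS]mulrAC ler_wpM2l// mulr_ge0// exprn_ge0// ltW.
have := ler_wpM2l e0 Le; have := ler_wpM2l e1' (lerD Lq Lp); lra.
Qed.

End Scheme.

(** * Rates achievable with feedback *)

Lemma fb_error_interval_le {R : realType} (eps d rho : R) n M (m0 : 'I_M) :
  0 <= eps <= 1 -> 0 <= d -> 0 <= rho ->
  eps + (1 - eps) * expR (- (d * ln (1 + expR (- rho)))) <= expR (- (d * rho)) ->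
  exists c : fb_code n M,
    fb_error eps c <= expR (- (d * rho)) ^+ n * M%:R `^ d.
Proof.
move=> e01 d0 rho0 rate; set sigma := ln (1 + expR (- rho)) in rate.
have sE : expR sigma = 1 + expR (- rho) by rewrite lnK// posrE addr_gt0 ?expR_gt0.
pose q := expR (- sigma); pose p := expR (- (sigma + rho)).
have p0 : 0 <= p by exact: expR_ge0.
have pq : p <= q by rewrite ler_expR lerN2 lerDl.
have pq1 : q + p = 1.
  by rewrite /p opprD expRD -[X in X + _]mulr1 -mulrDr -sE -expRD addNr expR0.
exists (interval_code p0 pq m0 n).
have MR : (0 : R) < M%:R by rewrite ltr0n (leq_ltn_trans _ (ltn_ord m0)).
rewrite /fb_error /fb_output /=.
rewrite (joint_pr_mean_tally eps n (fun m y => m != interval_dec p q m0 y)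
  (fun m y _ => interval_enc p q m y)).
have -> : finset.setT = compatible p q M [::].
  by apply/setP => m; rewrite !inE /= add0r ler0n ltr_nat ltn_ord.
have := undecoded_tally_le p0 pq pq1 m0 e01 d0 (expR_gt0 (- (d * rho))) _ _ n [::].
rewrite /= mul1r => H.
rewrite ler_pdivrMl//; apply: le_trans (H _ _) _.
- by rewrite -expR0 ler_expR oppr_le0 mulr_ge0.
- apply: le_trans rate; rewrite lerD2l ler_wpM2l ?subr_ge0//; first by case/andP: e01.
  (* For L = exp (- d rho), q^(1 + d) = exp (- d sigma) q and p^(1 + d) / L = exp (- d sigma) p;
     these add up to exp (- d sigma). *)
  rewrite -!expRM -expRN -expRD.
  have -> : - sigma * (1 + d) = - (d * sigma) + - sigma by ring.
  have -> : - - (d * rho) + - (sigma + rho) * (1 + d) = - (d * sigma) + - (sigma + rho) by ring.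
  by rewrite ![expR (- (d * sigma) + _)]expRD -mulrDr pq1 mulr1.
- by rewrite mulrCA ler_wpM2l ?exprn_ge0 ?expR_ge0// powRD ?(gt_eqF MR) ?implybT// powRr1// ltW.
Qed.

Lemma fb_achievable_lt {R : realType} (eps r rho : R) : 0 <= eps <= 1 -> 0 <= r ->
  r * ln 2 < rho -> rho < (1 - eps) * ln (1 + expR (- rho)) ->
  fb_achievable eps r.
Proof.
move=> e01 r0 rrho rate; split=> //.
have rln0 : 0 <= r * ln 2 by rewrite mulr_ge0// ln_ge0// ler1n.
have rho0 : 0 <= rho by lra.
(* Negating both arguments turns rho < (1 - eps) sigma into the hypothesis of [small_exponent]. *)
have [|d /andP[d0 d1]] := @small_exponent R eps (- rho) (- ln (1 + expR (- rho))) e01.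
  by lra.
rewrite !mulrN => hd.
have code n : {c : fb_code n (num_messages r n) | fb_error eps c <=
    expR (- (d * rho)) ^+ n * (num_messages r n)%:R `^ d}.
  apply: cid; have /andP[Mge _] := num_messages_bounds n r0.
  have M0 : (0 < num_messages r n)%N.
    by rewrite -(ltr0n R) (lt_le_trans (expR_gt0 _) Mge).
  exact: fb_error_interval_le (Ordinal M0) e01 (ltW d0) rho0 hd.
exists (fun n => sval (code n)).
have s0 : 0 < d * (rho - r * ln 2) by rewrite mulr_gt0// subr_gt0.
(* The constant 2^d absorbs the rounding of the number of messages. *)
apply: (squeeze_cvgr _ (cvg_cst 0) (expR_geometric (2 `^ d) s0)).
apply: nearW => n; apply/andP; split.
  rewrite /fb_error /fb_output.
  rewrite (joint_pr_mean_tally eps n (fun m y => m != fb_dec _ y)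
    (fun m y _ => fb_enc _ m y)).
  by rewrite mulr_ge0 ?invr_ge0// mean_tally_ge0.
apply: le_trans (svalP (code n)) _.
have /andP[_ Mle] := num_messages_bounds n r0.
apply: le_trans (ler_wpM2l _ (ge0_ler_powR (ltW d0) _ _ Mle)) _;
  rewrite ?nnegrE ?exprn_ge0 ?mulr_ge0 ?expR_ge0//.
rewrite powRM ?expR_ge0// mulrCA ler_wpM2l ?powR_ge0//.
by rewrite -expRM -!expRM_natl -expRD ler_expR; lra.
Qed.

(** * Comparison of the capacities *)

Lemma fb_achievable0 {R : realType} (eps : R) : fb_achievable eps 0.
Proof.
split=> //.
have M1 n : num_messages (0 : R) n = 1%N by rewrite /num_messages mulr0 powRr0 ceil1.
have M0 n : (0 < num_messages (0 : R) n)%N by rewrite M1.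
have rll n : fb_rll n (fun (_ : 'I_(num_messages (0 : R) n)) _ => false) by [].
exists (fun n => FbCode (fun=> Ordinal (M0 n)) (@rll n)).
apply: cvg_near_cst; apply: nearW => n.
rewrite /fb_error /joint_pr big_pred0// => -[m t] /=; apply/negbTE; rewrite negbK.
by rewrite -val_eqE /= -leqn0 -ltnS -(M1 n).
Qed.

Lemma nc_achievable_any_of_fb {R : realType} (eps r : R) :
  fb_achievable eps r -> nc_achievable any_pair eps r.
Proof.
move=> [r0 [c errc]]; split=> //.
have rll n : nc_rll any_pair n (fun m w (_ : bool) => fb_enc (c n) m w).
  by move=> m w z _ _ sw _; apply: fb_encP.
by exists (fun n => NcCode (fb_dec (c n)) (@rll n)).
Qed.

(** [any_pair] imposes the constraint on more pairs, so the same codes serve. *)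
Lemma nc_achievable_consistent_of_any {R : realType} (eps r : R) :
  nc_achievable any_pair eps r -> nc_achievable consistent_pair eps r.
Proof.
move=> [r0 [c errc]]; split=> //.
have rll n : nc_rll consistent_pair n (nc_enc (c n)).
  by move=> m w z th th' sw _; apply: (nc_encP (n := n)).
by exists (fun n => NcCode (nc_dec (c n)) (@rll n)).
Qed.

Lemma nc_capacity_le_fb {R : realType} (eps r : R) : 0 <= eps <= 1 ->
  nc_achievable consistent_pair eps r -> (r%:E <= fb_capacity eps)%E.
Proof.
move=> e01 ncr; have r0 := ncr.1.
have ln20 : (0 : R) < ln 2 by rewrite ln_gt0// ltr1n.
have e1 : 0 <= 1 - eps by rewrite subr_ge0; case/andP: e01.
have rate rho : 0 <= rho -> rho < r * ln 2 -> rho < (1 - eps) * ln (1 + expR (- rho)).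
  move=> rho0 rhor; rewrite ltNge; apply/negP => le_rate.
  (* Since sigma decreases, (1 - eps) sigma <= rho at [rho] becomes strict at the midpoint, and the
     converse then puts r ln 2 below a number smaller than itself. *)
  pose rho' := (rho + r * ln 2) / 2.
  have : r * ln 2 <= rho'.
    apply: (nc_converse e01 _ _ ncr); first by rewrite /rho'; lra.
    apply: (@le_lt_trans _ _ rho); last by rewrite /rho'; lra.
    apply: le_trans le_rate; rewrite ler_wpM2l// ler_ln ?posrE ?addr_gt0 ?expR_gt0//.
    by rewrite lerD2l ler_expR /rho'; lra.
  by rewrite /rho'; lra.
(* Rates are nonnegative, so r - e is truncated at 0, where a single message suffices. *)
apply/lee_subgt0Pr => e e0; pose r' := Num.max 0 (r - e).
apply: (@le_trans _ _ r'%:E); first by rewrite -EFinB lee_fin le_max lexx orbT.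
apply: ereal_sup_ubound; exists r' => //.
have [er|re] := lerP r e; first by rewrite /r' max_l ?subr_le0//; exact: fb_achievable0.
have r'E : r' = r - e by rewrite /r' max_r// subr_ge0 ltW.
have r'r : r' * ln 2 < r * ln 2 by rewrite ltr_pM2r// r'E; lra.
have r'0 : 0 <= r' * ln 2 by rewrite mulr_ge0 ?ltW// r'E subr_gt0.
apply: (@fb_achievable_lt _ _ _ ((r' * ln 2 + r * ln 2) / 2)) => //.
- by rewrite r'E subr_ge0 ltW.
- by lra.
- by apply: rate; lra.
Qed.

Theorem theorem2 (R : realType) (eps : R) (eps_ge0 : 0 <= eps)
    (eps_le1 : eps <= 1) :
  nc_capacity consistent_pair eps = fb_capacity eps /\
  nc_capacity any_pair eps = fb_capacity eps.
Proof.
have e01 : 0 <= eps <= 1 by apply/andP.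
have fb_any : (fb_capacity eps <= nc_capacity any_pair eps)%E.
  apply: le_ereal_sup => _ [r fbr <-]; exists r => //.
  exact: nc_achievable_any_of_fb.
have any_cons : (nc_capacity any_pair eps <= nc_capacity consistent_pair eps)%E.
  apply: le_ereal_sup => _ [r anyr <-]; exists r => //.
  exact: nc_achievable_consistent_of_any.
have cons_fb : (nc_capacity consistent_pair eps <= fb_capacity eps)%E.
  by apply: ge_ereal_sup => _ [r nc_r <-]; exact: nc_capacity_le_fb.
split; apply/le_anti/andP; split=> //; first exact: le_trans any_cons.
exact: le_trans cons_fb.
Qed.
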